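(* Suppose that the following two hypotheses hold. System: (a) $f(\mathbf 0_n,\mathbf 0_m)=\mathbf 0_n$ and $\Delta f_t(\mathbf 0_n,\mathbf 0_m)=\mathbf 0_n$ for all $t\in\mathbb N$; (b) $\mathbf 0_m$ lies in the interior of $\mathcal U$; (c) there is $L_f\in(0,\infty)$ with $\|f(x',u)-f(x'',u)\|\le L_f\|x'-x''\|$ for all $x',x''\in\mathcal X$, $u\in\mathcal U$; (d) for all $t\in\mathbb N$, $\|\Delta f_t(x',u')-\Delta f_t(x'',u'')\|\le L_{\Delta f}(\varepsilon_f)(\|x'-x''\|+\|u'-u''\|)$ for all $x',x''\in\mathcal X$, $u',u''\in\mathcal U$, where $\varepsilon_f\in[0,\bar\varepsilon_f]$ and $L_{\Delta f}:\mathbb R_+\to\mathbb R_+$ is increasing and continuous with $\lim_{\varepsilon\searrow0}L_{\Delta f}(\varepsilon)=0$. Cost controllability: there is a constant $\overline\gamma$ such that for every horizon $i\in\mathbb I_{1:\infty}$ there is $\gamma_i\in(0,\overline\gamma]$ with $V_i(x;f)\le(1+\gamma_i)\ell^\star(x)$ for all $x\in\mathcal X_{\mathrm{ROA}}(\ell)$. For each $x\in\mathcal X$ there exists a function $\beta_N:\mathbb R_+\to\mathbb R_+$ such that for all $t\in\mathbb N$, $$V_N(x;f)-V_N(x;F^\ast_{t,N})\le\beta_N(\varepsilon_f)\,V_N(x;F^\ast_{t,N}),$$ where $\beta_N(\cdot)=\beta^{(1)}_NL_{\Delta f}(\cdot)+\beta^{(2)}_N[L_{\Delta f}(\cdot)]^2$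 with $$\beta^{(1)}_N=2\left(\frac{\overline\lambda_Q^2}{\underline\lambda_Q}\sum_{k=1}^{N-1}\zeta_k+\frac{\overline\lambda_P^2}{\underline\lambda_P}\zeta_N\right)^{1/2},\qquad \beta^{(2)}_N=\overline\lambda_Q\sum_{k=1}^{N-1}\zeta_k+\overline\lambda_P\zeta_N,$$ and $\zeta_k=2(\underline\lambda_Q^{-1}+\underline\lambda_R^{-1})\sum_{i=0}^{k-1}L_f^{2i}$.
   Context: Notation. $\mathbb N$ contains $0$; $\mathbb I_{a:b}=\mathbb N\cap[a,b]$ and $\mathbb I_{1:\infty}=\{1,2,\dots\}$; $\mathbb R_+=[0,\infty)$; $\|\cdot\|$ is the 2-norm; $\|x\|_Q^2=x^\top Qx$; $\overline\lambda_S,\underline\lambda_S$ are the largest and smallest eigenvalues of a symmetric positive definite matrix $S$. System. $\mathcal X=\mathbb R^n$, $\mathcal U\subseteq\mathbb R^m$ is closed. The true system is $x_{t+1}=f^\ast_t(x_t,u_t)=f(x_t,u_t)+\Delta f_t(x_t,u_t)$, $t\in\mathbb N$, with nominal model $f:\mathcal X\times\mathcal U\to\mathcal X$ and mismatch $\Delta f_t:\mathcal X\times\mathcal U\to\mathcal X$. Write $F^\ast_{t,N}=\{f^\ast_\tau\}_{\tau=t}^{t+N-1}$, $F^\ast_{0,\infty}=\{f^\ast_t\}_{t=0}^\infty$. Costs. $\ell(x,u)=\|x\|_Q^2+\|u\|_R^2$ with $Q,R\succ0$; $\ell^\star(x)=\min_{u\in\mathcal U}\ell(x,u)=\|x\|_Q^2$;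 terminal cost $\ell_{\mathrm T}(x)=\|x\|_P^2$ with $P\succeq Q$. MPC value functions. For prediction horizon $N\ge1$, $V_N(x;f)$ is the optimal value of minimizing $\sum_{k=0}^{N-1}\ell(\xi_k,\nu_k)+\ell_{\mathrm T}(\xi_N)$ subject to $\xi_0=x$, $\xi_{k+1}=f(\xi_k,\nu_k)$, $\nu_k\in\mathcal U$ for $k\in\mathbb I_{0:N-1}$; $V_N(x;F^\ast_{t,N})$ is the optimal value of the same problem with dynamics $\xi_{k+1}=f^\ast_{t+k}(\xi_k,\nu_k)$. Optimal solutions of both problems are taken to exist. Region of attraction. $\mathcal X_{\mathrm{ROA}}(\ell)$ is the set of $x\in\mathcal X$ for which the infinite-horizon problem of minimizing $\sum_{k=0}^\infty\ell(\xi_k,\nu_k)$ subject to $\xi_0=x$, $\xi_{k+1}=f^\ast_k(\xi_k,\nu_k)$, $\nu_k\in\mathcal U$ has finite value. *)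

(* Defs.v *)
(* MathComp-Analysis, over an arbitrary [R : realType].  States and inputs are
   column vectors; the constraint set is [U : set 'cV[R]_m], and maps on X x U
   are total functions of which only the values at inputs in [U] matter. *)
From mathcomp Require Import all_boot all_order all_algebra.
From mathcomp Require Import all_classical all_reals all_analysis.

Set Implicit Arguments.
Unset Strict Implicit.
Unset Printing Implicit Defensive.

Import Order.TTheory GRing.Theory Num.Theory.
Import numFieldNormedType.Exports.

Local Open Scope classical_set_scope.
Local Open Scope ring_scope.

(* The norm [`|x|] that the library puts on matrices is the max-norm, so the
   2-norm is introduced here; both norms induce the same topology. *)
Definition norm2 (R : realType) n (x : 'cV[R]_n) : R :=
  Num.sqrt (\sum_(i < n) x i 0 ^+ 2).

(* ||x||_S^2 = x^T S x *)
Definition wnormsq (R : realType) n (S : 'M[R]_n) (x : 'cV[R]_n) : R :=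
  (x^T *m S *m x) 0 0.

Definition posdef (R : realType) n (S : 'M[R]_n) : Prop :=
  S^T = S /\ forall x : 'cV[R]_n, x != 0 -> 0 < wnormsq S x.

Definition possemidef (R : realType) n (S : 'M[R]_n) : Prop :=
  S^T = S /\ forall x : 'cV[R]_n, 0 <= wnormsq S x.

(* For n >= 1 and symmetric S the set of eigenvalues is finite and nonempty,
   so that [sup] and [inf] are a maximum and a minimum. *)
Definition eigmax (R : realType) n (S : 'M[R]_n) : R :=
  sup [set a : R | eigenvalue S a].

Definition eigmin (R : realType) n (S : 'M[R]_n) : R :=
  inf [set a : R | eigenvalue S a].

Section control.
Variables (R : realType) (n m : nat).
Implicit Types (U : set 'cV[R]_m) (Q P : 'M[R]_n) (W : 'M[R]_m).
Implicit Types (x : 'cV[R]_n) (xi : nat -> 'cV[R]_n) (nu : nat -> 'cV[R]_m).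
(* [g k] is the dynamics applied at step k of the prediction *)
Implicit Types (g : nat -> 'cV[R]_n -> 'cV[R]_m -> 'cV[R]_n).

Definition true_dyn (f : 'cV[R]_n -> 'cV[R]_m -> 'cV[R]_n)
    (Df : nat -> 'cV[R]_n -> 'cV[R]_m -> 'cV[R]_n) (t : nat)
    (x : 'cV[R]_n) (u : 'cV[R]_m) : 'cV[R]_n :=
  f x u + Df t x u.

Definition stage_cost Q W (x : 'cV[R]_n) (u : 'cV[R]_m) : R :=
  wnormsq Q x + wnormsq W u.

Definition stage_cost_min U Q W x : R :=
  inf [set stage_cost Q W x u | u in U].

(* Entries of [xi] beyond N and of [nu] beyond N - 1 are unconstrained and do
   not enter the cost. *)
Definition feasible U g (N : nat) x xi nu : Prop :=
  xi 0%N = x /\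
  forall k, (k < N)%N -> U (nu k) /\ xi k.+1 = g k (xi k) (nu k).

Definition mpc_cost Q W P (N : nat) xi nu : R :=
  \sum_(0 <= k < N) stage_cost Q W (xi k) (nu k) + wnormsq P (xi N).

Definition mpc_value U Q W P g (N : nat) x : R :=
  inf [set J : R | exists xi nu,
         feasible U g N x xi nu /\ J = mpc_cost Q W P N xi nu].

Definition mpc_has_optimum U Q W P g (N : nat) x : Prop :=
  exists xi nu, feasible U g N x xi nu /\
    forall xi' nu', feasible U g N x xi' nu' ->
      mpc_cost Q W P N xi nu <= mpc_cost Q W P N xi' nu'.

Definition feasible_inf U g x xi nu : Prop :=
  xi 0%N = x /\ forall k, U (nu k) /\ xi k.+1 = g k (xi k) (nu k).

Definition inf_value U Q W g x : \bar R :=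
  ereal_inf [set J : \bar R | exists xi nu, feasible_inf U g x xi nu /\
    J = (\sum_(0 <= k <oo) (stage_cost Q W (xi k) (nu k))%:E)%E].

Definition roa U Q W g : set 'cV[R]_n :=
  [set x | inf_value U Q W g x \is a fin_num].

Definition zeta Q W (Lf : R) (k : nat) : R :=
  2 * ((eigmin Q)^-1 + (eigmin W)^-1) * \sum_(0 <= i < k) Lf ^+ (2 * i).

Definition beta1 Q W P (Lf : R) (N : nat) : R :=
  2 * Num.sqrt (eigmax Q ^+ 2 / eigmin Q * (\sum_(1 <= k < N) zeta Q W Lf k)
                + eigmax P ^+ 2 / eigmin P * zeta Q W Lf N).

Definition beta2 Q W P (Lf : R) (N : nat) : R :=
  eigmax Q * (\sum_(1 <= k < N) zeta Q W Lf k) + eigmax P * zeta Q W Lf N.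

End control.

(* Main.v *)
(** Apply the optimal inputs of the true prediction problem to the nominal
    model.  The gap e_k between the two trajectories satisfies
    |e_{k+1}| <= Lf |e_k| + L (|xi_k| + |nu_k|), so by Cauchy-Schwarz
    |e_k|^2 <= zeta_k L^2 V with V the true optimal value.  The nominal cost is
    V + 2 D(xi, e) + D(e, e), where D sums the Q- and P-bilinear forms along the
    horizon: D(e, e) gives the beta2 term, and D(xi, e)^2 <= D(xi, xi) D(e, e)
    with D(xi, xi) <= V and eigmax <= eigmax^2 / eigmin gives the beta1 term. *)
Require Import Defs.
From mathcomp Require Import all_boot all_order all_algebra.
From mathcomp Require Import all_classical all_reals all_analysis.
From mathcomp Require Import ring lra.
Import Order.TTheory GRing.Theory Num.Theory.
Import numFieldNormedType.Exports.
Local Open Scope classical_set_scope.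
Local Open Scope ring_scope.

(** A quadratic polynomial without negative values has nonpositive discriminant. Both Cauchy-Schwarz
    inequalities below, for a single form and along a trajectory, come from it. *)
Lemma discriminant_le (R : realType) (a b c : R) : 0 <= c ->
  (forall t, 0 <= a + 2 * t * b + t ^+ 2 * c) -> b ^+ 2 <= a * c.
Proof.
rewrite le_eqVlt => /predU1P[<-|c0] h.
  rewrite mulr0; have [->|b0] := eqVneq b 0; first by rewrite expr0n.
  (* For [c = 0] and [b != 0] the polynomial is affine in [t] and takes the value -1 here. *)
  have := h (- (a + 1) / (2 * b)); rewrite mulr0 addr0.
  have -> : a + 2 * (- (a + 1) / (2 * b)) * b = -1 by field.
  by rewrite ler0N1.
(* The minimizer [- b / c]; multiplying the minimum by [c] leaves [a * c - b ^+ 2]. *)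
have := h (- b / c); rewrite -(pmulr_rge0 _ c0).
have -> : c * (a + 2 * (- b / c) * b + (- b / c) ^+ 2 * c) = a * c - b ^+ 2.
  by field; rewrite gt_eqF.
by rewrite subr_ge0.
Qed.

(** * Quadratic forms, the 2-norm and extreme eigenvalues *)

Section bilinear_forms.
Local Set Implicit Arguments.
Local Unset Strict Implicit.
Local Unset Printing Implicit Defensive.
Variable R : realType.

Definition bform n (S : 'M[R]_n) (x y : 'cV[R]_n) : R := (x^T *m S *m y) 0 0.

Lemma wnormsqE n (S : 'M[R]_n) x : wnormsq S x = bform S x x.
Proof. by []. Qed.

Lemma bformC n (S : 'M[R]_n) x y : S^T = S -> bform S x y = bform S y x.
Proof.
move=> hS; have e : x^T *m S *m y = (y^T *m S *m x)^T.
  by rewrite !trmx_mul hS trmxK mulmxA.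
by rewrite /bform e mxE.
Qed.

Lemma wnormsqD n (S : 'M[R]_n) x y : S^T = S ->
  wnormsq S (x + y) = wnormsq S x + 2 * bform S x y + wnormsq S y.
Proof.
move=> hS; rewrite /wnormsq [(x + y)^T]linearD /= !mulmxDl !mulmxDr.
have D (A B : 'M[R]_1) : (A + B) 0 0 = A 0 0 + B 0 0 by rewrite mxE.
have := bformC y x hS; rewrite !D /bform => ->; ring.
Qed.

Lemma bformZr n (S : 'M[R]_n) a x y : bform S x (a *: y) = a * bform S x y.
Proof. by rewrite /bform -scalemxAr mxE. Qed.

Lemma wnormsqZ n (S : 'M[R]_n) a x : wnormsq S (a *: x) = a ^+ 2 * wnormsq S x.
Proof. 
by rewrite /wnormsq [(a *: x)^T]linearZ /= -!scalemxAl -scalemxAr scalerA mxE expr2.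
Qed.

Lemma wnormsq0 n (S : 'M[R]_n) : wnormsq S 0 = 0.
Proof. by rewrite /wnormsq mulmx0 mxE. Qed.

Lemma wnormsqDl n (S T : 'M[R]_n) x :
  wnormsq (S + T) x = wnormsq S x + wnormsq T x.
Proof. by rewrite /wnormsq mulmxDr mulmxDl mxE. Qed.

Lemma wnormsqNl n (S : 'M[R]_n) x : wnormsq (- S) x = - wnormsq S x.
Proof. by rewrite /wnormsq mulmxN mulNmx mxE. Qed.

Lemma norm2_sqr n (x : 'cV[R]_n) : norm2 x ^+ 2 = \sum_i x i 0 ^+ 2.
Proof. by rewrite sqr_sqrtr // sumr_ge0 // => i _; rewrite sqr_ge0. Qed.

Lemma wnormsq_scalar n a (x : 'cV[R]_n) : wnormsq a%:M x = a * norm2 x ^+ 2.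
Proof.
rewrite /wnormsq mul_mx_scalar -scalemxAl mxE norm2_sqr mxE; congr (_ * _).
by apply: eq_bigr => i _; rewrite mxE expr2.
Qed.

Lemma norm2_ge0 n (x : 'cV[R]_n) : 0 <= norm2 x.
Proof. exact: sqrtr_ge0. Qed.

Lemma norm2_gt0 n (x : 'cV[R]_n) : x != 0 -> 0 < norm2 x.
Proof.
move=> x0; rewrite lt_neqAle norm2_ge0 andbT eq_sym.
apply: contra x0 => /eqP x0; have := norm2_sqr x.
rewrite x0 expr0n /= => /esym/eqP; rewrite psumr_eq0 => [/allP h|i _]; last exact: sqr_ge0.
apply/eqP/colP => i; have := h i; rewrite mem_index_enum sqrf_eq0 => /(_ isT).
by rewrite mxE => /eqP.
Qed.

Lemma norm20 n : norm2 (0 : 'cV[R]_n) = 0.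
Proof. by rewrite /norm2 big1 ?sqrtr0// => i _; rewrite mxE expr0n. Qed.

Lemma norm2N n (x : 'cV[R]_n) : norm2 (- x) = norm2 x.
Proof. by congr Num.sqrt; apply: eq_bigr => i _; rewrite mxE sqrrN. Qed.

Lemma bform_CS n (S : 'M[R]_n) x y : possemidef S ->
  bform S x y ^+ 2 <= wnormsq S x * wnormsq S y.
Proof.
move=> [hS S0]; apply: discriminant_le => // t.
by have := S0 (x + t *: y); rewrite wnormsqD// bformZr wnormsqZ mulrA.
Qed.

Lemma possemidef1 n : possemidef (1%:M : 'M[R]_n).
Proof. by split=> [|x]; rewrite ?trmx1// wnormsq_scalar mul1r sqr_ge0. Qed.

(** After squaring, this is Cauchy-Schwarz for the identity matrix. *)
Lemma norm2D n (x y : 'cV[R]_n) : norm2 (x + y) <= norm2 x + norm2 y.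
Proof.
have E (z : 'cV[R]_n) : norm2 z ^+ 2 = wnormsq 1%:M z by rewrite wnormsq_scalar mul1r.
rewrite -(@ler_pXn2r _ 2) ?nnegrE ?addr_ge0 ?norm2_ge0//.
rewrite sqrrD !E wnormsqD ?trmx1// lerD2r lerD2l -[leRHS]mulr_natl ler_pM2l//.
apply: le_trans (ler_norm _) _.
rewrite -(@ler_pXn2r _ 2) ?nnegrE ?mulr_ge0 ?norm2_ge0//.
by rewrite real_normK ?num_real// exprMn !E; apply/bform_CS/possemidef1.
Qed.

(** Each entry of [x] is at most [norm2 x] in absolute value, so the sum of the [|S i j|] would do;
    adding 1 makes [C] positive even for [S = 0], so that [C^-1] can be used. *)
Lemma wnormsq_bounded n (S : 'M[R]_n) :
  exists2 C, 0 < C & forall x, `|wnormsq S x| <= C * norm2 x ^+ 2.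
Proof.
exists (1 + \sum_i \sum_j `|S i j|).
  by rewrite ltr_pwDl// sumr_ge0// => i _; rewrite sumr_ge0.
move=> x; have xle i : `|x i 0| <= norm2 x.
  rewrite -(@ler_pXn2r _ 2) ?nnegrE ?norm2_ge0// real_normK ?num_real//.
  by rewrite norm2_sqr (bigD1 i)//= lerDl sumr_ge0// => j _; rewrite sqr_ge0.
rewrite mulrDl mul1r; apply: ler_wpDl; first exact: sqr_ge0.
rewrite /wnormsq -mulmxA mxE mulr_suml (le_trans (ler_norm_sum _ _ _))//.
apply: ler_sum => i _; rewrite !mxE mulr_sumr mulr_suml.
rewrite (le_trans (ler_norm_sum _ _ _))//; apply: ler_sum => j _.
rewrite !normrM mulrCA ler_wpM2l// expr2 ler_pM//.
Qed.

(* Let mu be the best constant with mu |x|^2 <= x^T S x.  If S - mu were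
   invertible, Cauchy-Schwarz for the form S - mu at x and (S - mu)^-1 x would
   bound it below by a positive multiple of |x|^2, against the choice of mu. *)
Lemma eigmin_spec n (S : 'M[R]_n) : (0 < n)%N -> S^T = S ->
  eigenvalue S (eigmin S) /\
  (forall x, eigmin S * norm2 x ^+ 2 <= wnormsq S x).
Proof.
move=> n0 hS.
pose A := [set c : R | forall x, c * norm2 x ^+ 2 <= wnormsq S x].
have hA : has_sup A.
  split.
    have [C _ hC] := wnormsq_bounded S; exists (- C) => x.
    by have := hC x; rewrite ler_norml mulNr => /andP[].
  pose e : 'cV[R]_n := const_mx 1.
  have e0 : 0 < norm2 e.
    apply: norm2_gt0; apply/eqP => /colP/(_ (Ordinal n0)).
    by rewrite !mxE => /eqP; rewrite oner_eq0.
  exists (wnormsq S e / norm2 e ^+ 2) => c /(_ e).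
  by rewrite ler_pdivlMr// exprn_gt0.
have muA : A (sup A).
  move=> x; have [->|x0] := eqVneq x 0.
    by rewrite norm20 expr0n mulr0 wnormsq0.
  rewrite -ler_pdivlMr ?exprn_gt0 ?norm2_gt0//; apply: ge_sup; first by case: hA.
  by move=> c /(_ x); rewrite ler_pdivlMr// exprn_gt0// norm2_gt0.
set mu := sup A in muA *.
have ev_mu : eigenvalue S mu.
  (* The eigenspace is the kernel of [S - mu%:M], so it is trivial exactly when this matrix is
     invertible. *)
  rewrite /eigenvalue /eigenspace kermx_eq0 row_free_unit; apply/negP => Tu.
  set T := S - mu%:M in Tu.
  have hT : possemidef T.
    split; first by rewrite /T linearB /= tr_scalar_mx hS.
    by move=> x; rewrite wnormsqDl wnormsqNl wnormsq_scalar subr_ge0; apply: muA.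
  have [C C0 hC] := wnormsq_bounded (invmx T).
  (* Membership of [mu + C^-1] in [A] would exceed the supremum [mu]. *)
  suff : A (mu + C^-1) by move/(ub_le_sup (proj2 hA)); rewrite gerDl leNgt invr_gt0 C0.
  move=> x; have [->|x0] := eqVneq x 0.
    by rewrite norm20 expr0n mulr0 wnormsq0.
  have x20 : 0 < norm2 x ^+ 2 by rewrite exprn_gt0// norm2_gt0.
  have := bform_CS x (invmx T *m x) hT.
  have -> : bform T x (invmx T *m x) = norm2 x ^+ 2.
    rewrite /bform mulmxA mulmxK//.
    by rewrite -[RHS]mul1r -wnormsq_scalar /wnormsq mulmx1.
  have -> : wnormsq T (invmx T *m x) = wnormsq (invmx T) x.
    rewrite /wnormsq trmx_mul trmx_inv (proj1 hT).
    by rewrite mulmxKV// mulmxA.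
  have := hC x; rewrite ler_norml => /andP[_ h1] h2.
  have : norm2 x ^+ 2 * norm2 x ^+ 2 <= wnormsq T x * C * norm2 x ^+ 2.
    by rewrite -expr2 -mulrA; apply: le_trans h2 _; rewrite ler_wpM2l// (proj2 hT).
  rewrite (ler_pM2r x20) -ler_pdivrMr//.
  rewrite /T wnormsqDl wnormsqNl wnormsq_scalar; lra.
(* It remains to see that [mu], already an eigenvalue, is below all others: test the form on
   eigenvectors. These are row vectors in [eigenvalueP], hence the transposes. *)
suff -> : eigmin S = mu by [].
have lb : lbound [set a | eigenvalue S a] mu.
  move=> a /eigenvalueP[v vS v0].
  have v0' : v^T != 0 by rewrite -trmx0 (inj_eq trmx_inj).
  have := muA v^T; have -> : wnormsq S v^T = a * norm2 v^T ^+ 2.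
    by rewrite /wnormsq trmxK vS -wnormsq_scalar /wnormsq trmxK mul_mx_scalar.
  by rewrite ler_pM2r// exprn_gt0// norm2_gt0.
apply/eqP; rewrite eq_le; apply/andP; split.
  by apply: ge_inf => //; exists mu.
by apply: lb_le_inf => //; exists mu.
Qed.

Lemma eigenvalueN n (S : 'M[R]_n) a : eigenvalue (- S) a = eigenvalue S (- a).
Proof.
apply/eigenvalueP/eigenvalueP => -[v h v0]; exists v => //.
  by rewrite scaleNr -h mulmxN opprK.
by rewrite mulmxN h scaleNr opprK.
Qed.

(** Apply [eigmin_spec] to [- S], whose eigenvalues are those of [S] negated. *)
Lemma eigmax_spec n (S : 'M[R]_n) : (0 < n)%N -> S^T = S ->
  eigenvalue S (eigmax S) /\
  (forall x, wnormsq S x <= eigmax S * norm2 x ^+ 2).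
Proof.
move=> n0 hS; have := @eigmin_spec n (- S) n0.
rewrite linearN /= hS => /(_ erefl).
have -> : eigmin (- S) = - eigmax S.
  rewrite /eigmin /inf; congr (- sup _); apply/seteqP; split=> [_ [a h <-]|a h].
    by rewrite /= -eigenvalueN.
  by exists (- a); rewrite /= ?opprK// eigenvalueN opprK.
rewrite eigenvalueN opprK => -[h1 h2]; split=> // x.
by have := h2 x; rewrite wnormsqNl mulNr lerN2.
Qed.

Lemma posdef_possemidef n (S : 'M[R]_n) : posdef S -> possemidef S.
Proof.
by move=> [hS h]; split=> // x; have [->|/h/ltW//] := eqVneq x 0; rewrite wnormsq0.
Qed.

(** The smallest eigenvalue is attained, and on its eigenvector the form equals [eigmin S] times the
    squared norm. *)
Lemma eigmin_gt0 n (S : 'M[R]_n) : (0 < n)%N -> posdef S -> 0 < eigmin S.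
Proof.
move=> n0 [hS h]; have [/eigenvalueP[v vS v0] _] := eigmin_spec n0 hS.
have v0' : v^T != 0 by rewrite -trmx0 (inj_eq trmx_inj).
have := h _ v0'; rewrite /wnormsq trmxK vS.
have -> : (eigmin S *: v *m v^T) 0 0 = eigmin S * norm2 v^T ^+ 2.
  by rewrite -wnormsq_scalar /wnormsq trmxK mul_mx_scalar.
by rewrite pmulr_lgt0// exprn_gt0// norm2_gt0.
Qed.

Lemma eigmin_le_eigmax n (S : 'M[R]_n) : (0 < n)%N -> S^T = S ->
  eigmin S <= eigmax S.
Proof.
move=> n0 hS; pose e : 'cV[R]_n := const_mx 1.
have e0 : 0 < norm2 e.
  apply: norm2_gt0; apply/eqP => /colP/(_ (Ordinal n0)).
  by rewrite !mxE => /eqP; rewrite oner_eq0.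
rewrite -(ler_pM2r (exprn_gt0 2 e0)).
exact: le_trans (proj2 (eigmin_spec n0 hS) e) (proj2 (eigmax_spec n0 hS) e).
Qed.

End bilinear_forms.

(** Unrolling gives [a k] at most the sum of the [L ^+ (k - 1 - i) * b i], and the bound is
    Cauchy-Schwarz for that sum. The induction reaches it without the unrolled form. *)
Lemma sqr_affine_rec_le (R : realType) (L : R) (a b : nat -> R) N :
  0 <= L -> (forall k, 0 <= a k) -> (forall k, 0 <= b k) -> a 0%N = 0 ->
  (forall k, (k < N)%N -> a k.+1 <= L * a k + b k) ->
  forall k, (k <= N)%N ->
    a k ^+ 2 <= (\sum_(0 <= i < k) L ^+ (2 * i)) * \sum_(0 <= i < k) b i ^+ 2.
Proof.
move=> L0 a0 b0 a00 ha; elim=> [_|k IH kN].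
  by rewrite a00 !big_geq// expr0n mul0r.
have {}IH := IH (ltnW kN).
(* Splitting the first power of [L] and the last [b] off turns the target into
   [(1 + L ^+ 2 * A) * (B + b k ^+ 2)]. *)
rewrite (big_nat_recl _ _ _ (leq0n k)) (big_nat_recr _ _ _ (leq0n k)) /= muln0 expr0.
have -> : \sum_(0 <= i < k) L ^+ (2 * i.+1) =
    L ^+ 2 * \sum_(0 <= i < k) L ^+ (2 * i).
  by rewrite mulr_sumr; apply: eq_bigr => i _; rewrite mulnS exprD.
set A := \sum_(0 <= i < k) _ in IH *; set B := \sum_(0 <= i < k) _ in IH *.
have A0 : 0 <= A by rewrite sumr_ge0// => i _; rewrite exprn_ge0.
have B0 : 0 <= B by rewrite sumr_ge0// => i _; rewrite sqr_ge0.
apply: (@le_trans _ _ ((L * a k + b k) ^+ 2)).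
  by rewrite lerXn2r ?nnegrE ?addr_ge0 ?mulr_ge0// ha.
(* AM-GM: [2 L a b <= L^2 A b^2 + B], since [a^2 <= A B] *)
have amgm : 2 * (L * a k * b k) <= L ^+ 2 * A * b k ^+ 2 + B.
  have r0 : 0 <= L ^+ 2 * A * b k ^+ 2 by rewrite !mulr_ge0// sqr_ge0.
  rewrite -(@ler_pXn2r _ 2) ?nnegrE ?addr_ge0 ?mulr_ge0//.
  apply: (@le_trans _ _ (4 * (L ^+ 2 * A * b k ^+ 2 * B))).
    have : L ^+ 2 * b k ^+ 2 * a k ^+ 2 <= L ^+ 2 * b k ^+ 2 * (A * B).
      by rewrite ler_wpM2l// mulr_ge0// sqr_ge0.
    nra.
  by have := sqr_ge0 (L ^+ 2 * A * b k ^+ 2 - B); nra.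
have : L ^+ 2 * a k ^+ 2 <= L ^+ 2 * (A * B) by rewrite ler_wpM2l// sqr_ge0.
nra.
Qed.

(** * Prediction costs and their perturbation along a trajectory *)

Section mpc.
Local Set Implicit Arguments.
Local Unset Strict Implicit.
Local Unset Printing Implicit Defensive.
Variables (R : realType) (n m : nat).
Implicit Types (U : set 'cV[R]_m) (Q P : 'M[R]_n) (W : 'M[R]_m).
Implicit Types (a b e xi : nat -> 'cV[R]_n) (nu : nat -> 'cV[R]_m).

(** The state part of [mpc_cost], polarised. Input terms are left out because the two trajectories
    compared share their inputs. *)
Definition traj_form Q P N a b : R :=
  \sum_(0 <= k < N) bform Q (a k) (b k) + bform P (a N) (b N).

Lemma traj_formD Q P N a b t : Q^T = Q -> P^T = P ->
  traj_form Q P N (fun k => a k + t *: b k) (fun k => a k + t *: b k) =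
  traj_form Q P N a a + 2 * t * traj_form Q P N a b + t ^+ 2 * traj_form Q P N b b.
Proof.
move=> hQ hP; rewrite /traj_form.
under eq_bigr => k _ do rewrite -wnormsqE wnormsqD// bformZr wnormsqZ.
rewrite -[X in _ + X = _]wnormsqE wnormsqD// bformZr wnormsqZ.
rewrite !big_split /= -!mulr_sumr !wnormsqE; ring.
Qed.

Lemma traj_form_ge0 Q P N a : possemidef Q -> possemidef P ->
  0 <= traj_form Q P N a a.
Proof.
by move=> [_ hQ] [_ hP]; rewrite addr_ge0 ?hP// sumr_ge0// => k _; apply: hQ.
Qed.

Lemma traj_form_CS Q P N a b : possemidef Q -> possemidef P ->
  traj_form Q P N a b ^+ 2 <= traj_form Q P N a a * traj_form Q P N b b.
Proof.
move=> hQ hP; apply: discriminant_le => [|t]; first exact: traj_form_ge0.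
by rewrite -traj_formD ?(proj1 hQ) ?(proj1 hP)// traj_form_ge0.
Qed.

Lemma mpc_costE Q W P N xi nu :
  mpc_cost Q W P N xi nu =
  traj_form Q P N xi xi + \sum_(0 <= k < N) wnormsq W (nu k).
Proof. by rewrite /mpc_cost /stage_cost big_split /= addrAC. Qed.

Lemma mpc_cost_ge0 Q W P N xi nu :
  possemidef Q -> possemidef W -> possemidef P -> 0 <= mpc_cost Q W P N xi nu.
Proof.
move=> hQ hW hP; rewrite mpc_costE addr_ge0 ?traj_form_ge0//.
by rewrite sumr_ge0// => k _; case: hW.
Qed.

(** Bounding [inf] by a member requires the set to be bounded below; nonnegativity of the cost
    provides 0. *)
Lemma mpc_value_le U Q W P g N x xi nu :
  possemidef Q -> possemidef W -> possemidef P -> feasible U g N x xi nu ->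
  mpc_value U Q W P g N x <= mpc_cost Q W P N xi nu.
Proof.
move=> hQ hW hP h; apply: ge_inf; last by exists xi, nu.
by exists 0 => _ [xi' [nu' [_ ->]]]; apply: mpc_cost_ge0.
Qed.

Lemma mpc_value_optimum U Q W P g N x xi nu :
  possemidef Q -> possemidef W -> possemidef P -> feasible U g N x xi nu ->
  (forall xi' nu', feasible U g N x xi' nu' ->
    mpc_cost Q W P N xi nu <= mpc_cost Q W P N xi' nu') ->
  mpc_value U Q W P g N x = mpc_cost Q W P N xi nu.
Proof.
move=> hQ hW hP h hmin; apply/eqP; rewrite eq_le mpc_value_le//=.
apply: lb_le_inf; first by exists (mpc_cost Q W P N xi nu), xi, nu.
by move=> _ [xi' [nu' [h' ->]]]; apply: hmin.
Qed.

Hypotheses (n_gt0 : (0 < n)%N) (m_gt0 : (0 < m)%N).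

(** Use [(p + q)^2 <= 2 (p^2 + q^2)] and bound each square by its form over [eigmin]; the sum of the
    two reciprocals dominates each of them. *)
Lemma sqr_norm2D_le_stage_cost Q W (x : 'cV[R]_n) (u : 'cV[R]_m) :
  posdef Q -> posdef W ->
  (norm2 x + norm2 u) ^+ 2 <=
  2 * ((eigmin Q)^-1 + (eigmin W)^-1) * stage_cost Q W x u.
Proof.
move=> hQ hW; have lQ := eigmin_gt0 n_gt0 hQ; have lW := eigmin_gt0 m_gt0 hW.
have [_ /(_ x) hx] := eigmin_spec n_gt0 (proj1 hQ).
have [_ /(_ u) hu] := eigmin_spec m_gt0 (proj1 hW).
have x0 : 0 <= wnormsq Q x by case: (posdef_possemidef hQ).
have u0 : 0 <= wnormsq W u by case: (posdef_possemidef hW).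
rewrite mulrC -ler_pdivlMr// in hx; rewrite mulrC -ler_pdivlMr// in hu.
have : 0 <= (eigmin W)^-1 * wnormsq Q x by rewrite mulr_ge0// invr_ge0 ltW.
have : 0 <= (eigmin Q)^-1 * wnormsq W u by rewrite mulr_ge0// invr_ge0 ltW.
have := sqr_ge0 (norm2 x - norm2 u); rewrite /stage_cost; nra.
Qed.

(** The two factors of [zeta] arise here: the geometric sum from the recursion, the prefactor from
    the stage cost bound. *)
Lemma traj_diff_le Q W Lf d N e xi nu :
  posdef Q -> posdef W -> 0 <= Lf -> 0 <= d -> e 0%N = 0 ->
  (forall k, (k < N)%N ->
    norm2 (e k.+1) <= Lf * norm2 (e k) + d * (norm2 (xi k) + norm2 (nu k))) ->
  forall k, (k <= N)%N -> norm2 (e k) ^+ 2 <=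
    zeta Q W Lf k * (d ^+ 2 * \sum_(0 <= i < N) stage_cost Q W (xi i) (nu i)).
Proof.
move=> hQ hW Lf0 d0 e0 he k kN.
have sc0 i : 0 <= stage_cost Q W (xi i) (nu i).
  by rewrite addr_ge0//; [case: (posdef_possemidef hQ)|case: (posdef_possemidef hW)].
have S0 : 0 <= \sum_(0 <= i < k) Lf ^+ (2 * i).
  by rewrite sumr_ge0// => i _; rewrite exprn_ge0.
have c0 : 0 <= 2 * ((eigmin Q)^-1 + (eigmin W)^-1).
  by rewrite mulr_ge0// addr_ge0// invr_ge0 ltW// eigmin_gt0.
have := @sqr_affine_rec_le _ Lf (fun k => norm2 (e k))
  (fun k => d * (norm2 (xi k) + norm2 (nu k))) N Lf0.
move=> /(_ (fun=> norm2_ge0 _)) /= h; apply: le_trans (h _ _ _ _ kN) _ => //.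
- by move=> i; rewrite mulr_ge0// addr_ge0// norm2_ge0.
- by rewrite e0 norm20.
have -> : zeta Q W Lf k =
    (\sum_(0 <= i < k) Lf ^+ (2 * i)) * (2 * ((eigmin Q)^-1 + (eigmin W)^-1)).
  exact: mulrC.
rewrite -[leRHS]mulrA; apply: ler_wpM2l => //.
rewrite (mulrCA _ (d ^+ 2)) !mulr_sumr.
apply: (@le_trans _ _ (\sum_(0 <= i < k) d ^+ 2 *
    (2 * ((eigmin Q)^-1 + (eigmin W)^-1) * stage_cost Q W (xi i) (nu i)))).
  apply: ler_sum => i _; rewrite exprMn ler_wpM2l ?sqr_ge0//.
  exact: sqr_norm2D_le_stage_cost.
(* Stage costs from [k] to [N - 1] are nonnegative, so the sum may be extended to the whole
   horizon. *)
rewrite [leRHS](big_cat_nat (leq0n k) kN)//= lerDl sumr_ge0// => i _.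
by apply: mulr_ge0; [exact: sqr_ge0|exact: mulr_ge0].
Qed.

(** The constants stay general because the bound is used twice: with [eigmax] for [beta2] and with
    [eigmax ^+ 2 / eigmin] for [beta1]. *)
Lemma traj_form_le Q P cQ cP N e (z : nat -> R) (w : R) :
  0 <= cQ -> 0 <= cP ->
  (forall x, wnormsq Q x <= cQ * norm2 x ^+ 2) ->
  (forall x, wnormsq P x <= cP * norm2 x ^+ 2) ->
  (0 < N)%N -> e 0%N = 0 ->
  (forall k, (k <= N)%N -> norm2 (e k) ^+ 2 <= z k * w) ->
  traj_form Q P N e e <= (cQ * (\sum_(1 <= k < N) z k) + cP * z N) * w.
Proof.
move=> cQ0 cP0 hQ hP N0 e0 he; rewrite mulrDl; apply: lerD.
  (* The term at 0 vanishes with [e 0], so the sum starts at 1. *)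
  rewrite big_ltn// e0 -wnormsqE wnormsq0 add0r -mulrA mulr_suml mulr_sumr.
  apply: ler_sum_nat => k /andP[_ kN]; apply: le_trans (hQ _) _.
  by rewrite ler_wpM2l// he// ltnW.
by apply: le_trans (hP _) _; rewrite -mulrA ler_wpM2l// he.
Qed.

Lemma zeta_ge0 Q W Lf k : posdef Q -> posdef W -> 0 <= Lf -> 0 <= zeta Q W Lf k.
Proof.
move=> hQ hW Lf0; rewrite !mulr_ge0// ?addr_ge0// ?invr_ge0 ?(ltW (eigmin_gt0 _ _))//.
by rewrite sumr_ge0// => i _; rewrite exprn_ge0.
Qed.

Lemma eigmax_le_sqr_div (S : 'M[R]_n) : posdef S ->
  0 <= eigmax S <= eigmax S ^+ 2 / eigmin S.
Proof.
move=> hS; have l0 := eigmin_gt0 n_gt0 hS.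
have lL := eigmin_le_eigmax n_gt0 (proj1 hS).
have L0 : 0 <= eigmax S by apply: le_trans lL; apply: ltW.
by rewrite L0 ler_pdivlMr// expr2 ler_pM// ltW.
Qed.

Lemma beta1_ge0 Q W P Lf N : 0 <= beta1 Q W P Lf N.
Proof. by rewrite mulr_ge0// sqrtr_ge0. Qed.

Lemma beta2_ge0 Q W P Lf N : posdef Q -> posdef W -> posdef P -> 0 <= Lf ->
  0 <= beta2 Q W P Lf N.
Proof.
move=> hQ hW hP Lf0.
have /andP[LQ _] := eigmax_le_sqr_div hQ; have /andP[LP _] := eigmax_le_sqr_div hP.
apply: addr_ge0; apply: mulr_ge0 => //; last exact: zeta_ge0.
by rewrite sumr_ge0// => k _; exact: zeta_ge0.
Qed.

Lemma mpc_cost_perturb Q W P Lf d N e xi nu :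
  posdef Q -> posdef W -> posdef P -> 0 <= Lf -> 0 <= d -> (0 < N)%N ->
  e 0%N = 0 ->
  (forall k, (k < N)%N ->
    norm2 (e k.+1) <= Lf * norm2 (e k) + d * (norm2 (xi k) + norm2 (nu k))) ->
  mpc_cost Q W P N (fun k => xi k + e k) nu - mpc_cost Q W P N xi nu <=
  (beta1 Q W P Lf N * d + beta2 Q W P Lf N * d ^+ 2) * mpc_cost Q W P N xi nu.
Proof.
move=> hQ hW hP Lf0 d0 N0 e0 he.
have [sQ sW sP] := And3 (posdef_possemidef hQ) (posdef_possemidef hW) (posdef_possemidef hP).
set V := mpc_cost Q W P N xi nu.
have V0 : 0 <= V by apply: mpc_cost_ge0.
(* Adding the terminal cost enlarges the sum of stage costs to [V]. *)
have nV k : (k <= N)%N -> norm2 (e k) ^+ 2 <= zeta Q W Lf k * (d ^+ 2 * V).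
  move=> kN; apply: le_trans (traj_diff_le hQ hW Lf0 d0 e0 he kN) _.
  by rewrite !ler_wpM2l ?zeta_ge0 ?sqr_ge0// lerDl; case: sP.
have /andP[LQ0 LQ] := eigmax_le_sqr_div hQ; have /andP[LP0 LP] := eigmax_le_sqr_div hP.
have [_ hLQ] := eigmax_spec n_gt0 (proj1 hQ).
have [_ hLP] := eigmax_spec n_gt0 (proj1 hP).
have E2 : traj_form Q P N e e <= beta2 Q W P Lf N * (d ^+ 2 * V).
  exact: (traj_form_le LQ0 LP0 hLQ hLP N0 e0 nV).
pose B := eigmax Q ^+ 2 / eigmin Q * (\sum_(1 <= k < N) zeta Q W Lf k)
          + eigmax P ^+ 2 / eigmin P * zeta Q W Lf N.
have E1 : traj_form Q P N e e <= B * (d ^+ 2 * V).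
  have hLQ' x := le_trans (hLQ x) (ler_wpM2r (sqr_ge0 (norm2 x)) LQ).
  have hLP' x := le_trans (hLP x) (ler_wpM2r (sqr_ge0 (norm2 x)) LP).
  exact: (traj_form_le (le_trans LQ0 LQ) (le_trans LP0 LP) hLQ' hLP' N0 e0 nV).
have B0 : 0 <= B.
  apply: addr_ge0; apply: mulr_ge0.
  - exact: le_trans LQ0 LQ.
  - by rewrite sumr_ge0// => k _; rewrite zeta_ge0.
  - exact: le_trans LP0 LP.
  - exact: zeta_ge0.
have xV : traj_form Q P N xi xi <= V.
  by rewrite /V mpc_costE lerDl sumr_ge0// => k _; case: sW.
(* Compare squares: Cauchy-Schwarz, [xV] and [E1] give [V * (B * (d ^+ 2 * V))], the square of the
   right-hand side. *)
have cross : traj_form Q P N xi e <= Num.sqrt B * d * V.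
  apply: le_trans (ler_norm _) _.
  rewrite -(@ler_pXn2r _ 2) ?nnegrE ?mulr_ge0 ?sqrtr_ge0//.
  rewrite real_normK ?num_real//; apply: le_trans (traj_form_CS _ _ _ sQ sP) _.
  apply: (@le_trans _ _ (V * (B * (d ^+ 2 * V)))).
    by rewrite ler_pM// traj_form_ge0.
  by rewrite !exprMn sqr_sqrtr// le_eqVlt; apply/orP; left; apply/eqP; ring.
(* The expansion at [t = 1]; the input costs cancel in the difference. *)
have := traj_formD N xi e 1 (proj1 hQ) (proj1 hP).
rewrite /V !mpc_costE opprD addrACA subrr addr0 -/V => hD.
have -> : traj_form Q P N (fun k => xi k + e k) (fun k => xi k + e k) =
    traj_form Q P N (fun k => xi k + 1 *: e k) (fun k => xi k + 1 *: e k).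
  by under [in RHS]eq_fun => k do rewrite scale1r.
rewrite hD -mpc_costE -/V {1}/beta1 -/B; nra.
Qed.

End mpc.

(** * Comparison of the nominal and true value functions *)

Lemma posdefD_possemidef (R : realType) (n : nat) (Q P : 'M[R]_n) :
  posdef Q -> possemidef (P - Q) -> posdef P.
Proof.
move=> [hQ Q0] [hPQ PQ0]; rewrite -(subrK Q P); split=> [|x x0].
  by rewrite linearD /= hPQ hQ.
by rewrite wnormsqDl ltr_wpDl// Q0.
Qed.

Theorem proposition2 (R : realType) (n m : nat) (hn : (0 < n)%N) (hm : (0 < m)%N)
    (U : set 'cV[R]_m) (hU : closed U)
    (f : 'cV[R]_n -> 'cV[R]_m -> 'cV[R]_n)
    (Df : nat -> 'cV[R]_n -> 'cV[R]_m -> 'cV[R]_n)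
    (Q : 'M[R]_n) (W : 'M[R]_m) (P : 'M[R]_n)
    (hQ : posdef Q) (hW : posdef W) (hP : possemidef (P - Q))
    (* optimal solutions exist *)
    (hopt_nominal : forall (i : nat) (x : 'cV[R]_n), (1 <= i)%N ->
       mpc_has_optimum U Q W P (fun _ => f) i x)
    (hopt_true : forall (t i : nat) (x : 'cV[R]_n), (1 <= i)%N ->
       mpc_has_optimum U Q W P (fun k => true_dyn f Df (t + k)%N) i x)
    (* system hypothesis *)
    (hf0 : f 0 0 = 0) (hDf0 : forall t : nat, Df t 0 0 = 0)
    (hU0 : interior U 0)
    (Lf : R) (hLf : 0 < Lf)
    (hfLip : forall (x' x'' : 'cV[R]_n) (u : 'cV[R]_m), U u ->
       norm2 (f x' u - f x'' u) <= Lf * norm2 (x' - x''))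
    (eps_bar eps : R) (heps : 0 <= eps <= eps_bar)
    (LD : R -> R)
    (hLD_ge0 : forall e : R, 0 <= e -> 0 <= LD e)
    (hLD_incr : forall e e' : R, 0 <= e -> e <= e' -> LD e <= LD e')
    (hLD_cont : {within `[0, +oo[, continuous LD})
    (hLD_lim : LD e @[e --> 0^'+] --> (0 : R))
    (hDfLip : forall (t : nat) (x' x'' : 'cV[R]_n) (u' u'' : 'cV[R]_m),
       U u' -> U u'' ->
       norm2 (Df t x' u' - Df t x'' u'')
         <= LD eps * (norm2 (x' - x'') + norm2 (u' - u'')))
    (* cost controllability *)
    (hcost : exists gamma_bar : R, forall i : nat, (1 <= i)%N ->
       exists gamma : R, 0 < gamma <= gamma_bar /\
         forall x : 'cV[R]_n, roa U Q W (true_dyn f Df) x ->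
           mpc_value U Q W P (fun _ => f) i x
             <= (1 + gamma) * stage_cost_min U Q W x)
    (N : nat) (hN : (1 <= N)%N) :
  forall x : 'cV[R]_n, exists beta : R -> R,
    [/\ forall e : R, 0 <= e -> 0 <= beta e,
        forall e : R, 0 <= e ->
          beta e = beta1 Q W P Lf N * LD e + beta2 Q W P Lf N * LD e ^+ 2
      & forall t : nat,
          mpc_value U Q W P (fun _ => f) N x
            - mpc_value U Q W P (fun k => true_dyn f Df (t + k)%N) N x
          <= beta eps
             * mpc_value U Q W P (fun k => true_dyn f Df (t + k)%N) N x].
Proof.
have Lf0 := ltW hLf; have hP' := posdefD_possemidef _ _ _ _ hQ hP.
have [sQ sW sP] := And3 (posdef_possemidef hQ) (posdef_possemidef hW) (posdef_possemidef hP').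
have eps0 : 0 <= eps by case/andP: heps.
have U0 : U 0 by apply: interior_subset.
(* The same function serves every [x]. *)
move=> x; exists (fun e => beta1 Q W P Lf N * LD e + beta2 Q W P Lf N * LD e ^+ 2).
split=> // [e e0|t].
  by rewrite addr_ge0// mulr_ge0 ?beta1_ge0 ?beta2_ge0 ?exprn_ge0 ?hLD_ge0.
have [xi [nu [hfeas hmin]]] := hopt_true t N x hN.
rewrite (mpc_value_optimum sQ sW sP hfeas hmin).
have [xi0 hxi] := hfeas.
(* The nominal trajectory driven by the optimal inputs [nu] of the true problem; its cost bounds the
   nominal value from above. *)
pose eta := fix eta k := if k is k'.+1 then f (eta k') (nu k') else x.
have heta : feasible U (fun _ => f) N x eta nu.
  by split=> // k /hxi[].
have etaE : eta = fun k => xi k + (eta k - xi k).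
  by apply/funext => k; rewrite addrCA subrr addr0.
apply: (le_trans (lerB (mpc_value_le sQ sW sP heta) (lexx _))).
rewrite {1}etaE; apply: mpc_cost_perturb => //; first exact: hLD_ge0.
  by rewrite xi0 subrr.
move=> k /hxi[Uk ->]; rewrite /true_dyn /= opprD addrA.
apply: le_trans (norm2D _ _) _; rewrite norm2N lerD ?hfLip//.
(* Comparison with the origin, where the mismatch vanishes, turns the Lipschitz bound into one on
   the mismatch itself; 0 is an admissible input by [U0]. *)
have := hDfLip (t + k)%N (xi k) 0 (nu k) 0 Uk U0.
by rewrite hDf0 !subr0.
Qed.
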